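(* Let $p\ge 0$ be an integer, let $P$ be a tree with $p+1$ vertices and let $v\in V(P)$. For $n\ge p+1$, let $\mathbb{P}_n$ be the uniform probability measure on the set of all labelled trees with vertex set $\{v_1,\dots,v_n\}$, and let $P_n(T)$ denote the number of $(v,P)$-patterns in such a tree $T$. Then $$\mathbb{P}_n(P_n\geq 1)\longrightarrow 1\quad\text{as } n\to+\infty .$$
   Context: Graphs are finite, undirected and without loops (and without multiple edges); a tree is a connected graph without cycles. A rooted tree $(v,P)$ is a tree $P$ with a distinguished vertex $v$; an isomorphism of rooted trees $(v,T)\to(v',T')$ is a graph isomorphism $T\to T'$ sending $v$ to $v'$. Let $(v,P)$ be a rooted tree with $p+1$ vertices, and let $T$ be a tree with vertex set $\{v_1,\dots,v_n\}$, $n\ge p+1$. For pairwise distinct indices $j,i_1,\dots,i_p\in\{1,\dots,n\}$, let $\widetilde T$ be the subgraph of $T$ induced on $\{v_j,v_{i_1},\dots,v_{i_p}\}$. The pair $(v_j,\{v_j,v_{i_1},\dots,v_{i_p}\})$ is called a $(v,P)$-pattern in $T$ if: (1) there is an isomorphism of rooted trees $(v_j,\widetilde T)\to(v,P)$; (2) $\deg_T(v_j)=\deg_{\widetilde T}(v_j)+1$; (3) $\deg_T(v_{i_k})=\deg_{\widetilde T}(v_{i_k})$ for all $1\le k\le p$. Thus a pattern is determined by the root $v_j$ and the unordered set of the other vertices, and $P_n(T)$ counts each such pair (root, set of vertices) once. *)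

(* Defs.v *)
From mathcomp Require Import all_boot all_order all_algebra.
From mathcomp Require Import reals.

Set Implicit Arguments.
Unset Strict Implicit.
Unset Printing Implicit Defensive.

Section Graphs.
Variable V : finType.
Implicit Types (E : {set {set V}}) (W : {set V}) (x y r : V).

(* A graph on the vertex set V is given by its set of edges, an edge being an
   unordered pair of distinct vertices; loops and multiple edges are thereby
   excluded. *)
Definition is_graph E : bool := [forall e in E, #|e| == 2].

Definition adj E : rel V := fun x y => [set x; y] \in E.

Definition deg E x : nat := #|[set y | adj E x y]|.

Definition connected_graph E : bool :=
  [forall x, forall y, connect (adj E) x y].

(* A cycle is a cyclic sequence of at least three pairwise distinct vertices;
   its length cannot exceed #|V|, which makes the property decidable, see
   acyclicP below. *)
Definition acyclic E : bool :=
  [forall k : 'I_#|V|.+1, forall c : k.-tuple V,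
     (2 < k) ==> ~~ ucycleb (adj E) c].

Lemma acyclicP E :
  reflect (forall c : seq V, ucycle (adj E) c -> size c <= 2) (acyclic E).
Proof.
apply: (iffP forallP) => [acE c ucE | acE k].
  rewrite leqNgt; apply/negP => c_gt2.
  have c_le : size c < #|V|.+1.
    by rewrite ltnS; case/andP: ucE => _ /card_uniqP <-; apply: max_card.
  have /forallP/(_ (in_tuple c)) := acE (Ordinal c_le).
  by rewrite /= c_gt2 /= => /negP; apply.
apply/forallP => c; apply/implyP => k_gt2; apply/negP => ucE.
by have := acE c ucE; rewrite size_tuple leqNgt k_gt2.
Qed.

Definition is_tree E : bool :=
  [&& is_graph E, connected_graph E & acyclic E].

(* Edges of the subgraph induced on W; its vertex set is W. *)
Definition induced E W : {set {set V}} := [set e in E | e \subset W].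

End Graphs.

Section Patterns.
Variables (U V : finType) (P : {set {set U}}) (v : U) (T : {set {set V}}).
Implicit Types (r : V) (W : {set V}).

(* f, restricted to W, is an isomorphism of rooted graphs from
   (r, subgraph of T induced on W) to (v, P), where P has vertex set U;
   the values of f outside W are irrelevant. *)
Definition is_rooted_iso r W (f : V -> U) : bool :=
  [&& f r == v,
      dinjectiveb f W,
      f @: W == [set: U] &
      [forall x in W, forall y in W,
         adj (induced T W) x y == adj P (f x) (f y)]].

(* W is the set of all the vertices of the pattern, root included. *)
Definition is_pattern r W : bool :=
  [&& r \in W,
      #|W| == #|U|,
      [exists f : {ffun V -> U}, is_rooted_iso r W f],
      deg T r == (deg (induced T W) r).+1 &
      [forall x in W, (x != r) ==> (deg T x == deg (induced T W) x)]].

Definition num_patterns : nat :=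
  #|[set rW : V * {set V} | is_pattern rW.1 rW.2]|.

End Patterns.

Definition labelled_trees (n : nat) : {set {set {set 'I_n}}} :=
  [set T | is_tree T].

(* Probability of the event A under the uniform probability measure on the
   finite set Omega. *)
Definition uniform_pr (R : realType) (X : finType) (Omega A : {set X}) : R :=
  (#|A :&: Omega|%:R / #|Omega|%:R)%R.

(* Main.v *)
Require Import Defs.
From mathcomp Require Import all_boot all_order all_algebra.
From mathcomp Require Import all_classical all_reals all_analysis.
From mathcomp Require Import zify.
From mathcomp Require Import fintype finset.
Import Order.TTheory GRing.Theory Num.Theory.
Import numFieldNormedType.Exports.

Set Implicit Arguments.
Unset Strict Implicit.
Unset Printing Implicit Defensive.

(** A switching argument: trees are transformed into other trees by local
    surgery, and counting each surgery from both ends compares the numbers of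
    trees of two kinds.

    Fixing a root [rho] identifies the trees on [V] with the maps [f] that fix
    [rho] and send every vertex to [rho] after finitely many steps: [f x] is the
    parent of [x] (lemmas [edges_of_tree], [edges_of_inj], [tree_edges_of]).
    Surgeries are then changes of values of [f]. A copy of the rooted tree [P]
    hanging from the rest of the tree by one edge at its root is a pattern
    ([planted_pattern]), so it suffices to show that, among the [t] rooted maps
    on [n] vertices, the proportion of those without a planted copy tends to 0.

    First surgery, producing a leaf. A tree with at most [m] leaves has about
    [n - 2m] vertices with exactly one child. Take such a vertex [x] out of the
    tree, joining its child to its parent, and hang [x] back as a leaf below one
    of the [n - 1] other vertices. To undo this one must name [x], among at most
    [m + 1] leaves, and its former child, so the proportion of trees with at
    most [m] leaves is at most [(m + 1) n / ((n - 2m - 1) (n - 1))]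
    ([few_leaves_rare]), which is of order [1 / k] when [m = n / k].

    Second surgery, producing a pattern. Let [q = p + 1] be the number of
    vertices of [P]. In a tree without planted copy and with more than [m]
    leaves, choose [q] leaves and rearrange them into a copy of [P], leaving the
    leaf that plays the root attached where it was. There are at least
    [(m + 1) m ... (m - q + 2)] choices. To undo this one must name the
    old parents of [q - 1] vertices, at most [n ^ (q - 1)] choices, and the
    copy that was created. For the latter the number of choices is bounded in
    terms of [q] alone: planted copies that meet have the same vertices
    ([planted_overlap]), and a copy that was not there before must contain one
    of the leaves that were moved or one of their old parents ([new_planted]).
    Since [m] is of order [n], the proportion of such trees is [O(1 / n)]
    ([pattern_free_rare]).

    Adding the two bounds, the proportion of trees without pattern is at most
    [17 / k] once [n] is large, for every [k > 3]. *)

(** * Trees as parent maps *)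
Section RootedMaps.
Variables (V : finType) (rho : V).
Implicit Types (f g : {ffun V -> V}) (x y : V).

Definition rooted_map f : bool :=
  (f rho == rho) && [forall x, fconnect f x rho].

Definition edges_of f : {set {set V}} :=
  [set [set x; f x] | x in predC1 rho]%SET.

Lemma rooted_map_root f : rooted_map f -> f rho = rho.
Proof. by case/andP=> /eqP. Qed.

Lemma rooted_map_connect f x : rooted_map f -> fconnect f x rho.
Proof. by case/andP=> _ /forallP. Qed.

(** Induction from the root towards the leaves. *)
Lemma rooted_map_ind f : rooted_map f -> forall Q : V -> Prop, Q rho ->
  (forall x, x != rho -> Q (f x) -> Q x) -> forall x, Q x.
Proof.
move=> rf Q Q0 QS x; have := iter_findex (rooted_map_connect x rf).
move: (findex f x rho) => k; elim: k x => [|k IHk] x; first by move=> /= ->.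
rewrite iterSr => /IHk Qfx.
by have [->//|xr] := eqVneq x rho; apply: QS.
Qed.
Arguments rooted_map_ind [f] rf Q.

Lemma rooted_map_neq f x : rooted_map f -> x != rho -> f x != x.
Proof.
move=> rf; apply: contraNneq.
elim/(rooted_map_ind rf): x => [//|x _ IHx fx].
by rewrite -fx; apply: IHx; rewrite !fx.
Qed.

Lemma rooted_map_neq2 f x : rooted_map f -> x != rho -> f (f x) != x.
Proof.
move=> rf; apply: contraNneq.
elim/(rooted_map_ind rf): x => [//|x _ IHx ffx].
by rewrite -ffx (eqP (IHx _)) ?ffx // (rooted_map_root rf).
Qed.

Lemma adj_edges_of f x y : adj (edges_of f) x y =
  (x != rho) && (f x == y) || (y != rho) && (f y == x).
Proof.
apply/imsetP/orP => [[z zr exy]|[]/andP[zr /eqP fz]].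
- have : x \in [set z; f z]%SET by rewrite -exy set21.
  have : y \in [set z; f z]%SET by rewrite -exy set22.
  have : z \in [set x; y]%SET by rewrite exy set21.
  have : f z \in [set x; y]%SET by rewrite exy set22.
  rewrite !inE in zr *; have [->|xz] := eqVneq x z.
    rewrite zr => /orP[] /eqP fz _ /orP[] /eqP yz;
      by left; apply/eqP; congruence.
  rewrite /= => _ /eqP <- _ /eqP ->.
  by right; rewrite zr eqxx.
- by exists x; rewrite ?inE // fz.
- by exists y; rewrite ?inE // fz finset.setUC.
Qed.

(** No cycle: a vertex of a cycle that is farthest from the root could only be
    adjacent, inside the cycle, to its own parent. *)
Lemma edges_of_tree f : rooted_map f -> is_tree (edges_of f).
Proof.
move=> rf; have adjC : symmetric (adj (edges_of f)).
  by move=> x y; rewrite !adj_edges_of orbC.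
apply/and3P; split.
- apply/forall_inP => _ /imsetP[x xr ->].
  by rewrite cards2 [x == _]eq_sym rooted_map_neq.
- suff toroot x : connect (adj (edges_of f)) x rho.
    apply/forallP => x; apply/forallP => y; apply: connect_trans (toroot x) _.
    by rewrite (sym_connect_sym adjC).
  elim/(rooted_map_ind rf): x => [//|x xr]; apply: connect_trans.
  by apply: connect1; rewrite adj_edges_of xr eqxx.
apply/acyclicP => c /andP[cyc_c uniq_c].
case: (c =P [::]) => [->//|/eqP]; rewrite -size_eq0 -lt0n => c_gt0.
have [x0 x0c] : exists x0, x0 \in c.
  by case: c c_gt0 {cyc_c uniq_c} => // x0 c; exists x0; rewrite mem_head.
have [x xc xmax] := @arg_maxnP _ x0 (mem c) (fun x => findex f x rho) x0c.
have up y : y \in c -> adj (edges_of f) x y -> y = f x.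
  rewrite adj_edges_of => yc /orP[/andP[_ /eqP//]|/andP[yr /eqP fy]].
  have := xmax _ yc; rewrite eq_sym in yr.
  by rewrite (fconnect_findex (rooted_map_connect y rf) yr) fy /= ltnn.
have [i c' rot_c] := rot_to xc.
have memc y : (y \in x :: c') = (y \in c) by rewrite -rot_c mem_rot.
move: cyc_c uniq_c; rewrite -(rot_cycle i) -(rot_uniq i) -(size_rot i) rot_c.
case: c' memc {rot_c} => [//|y [//|z s]] memc /=.
rewrite rcons_path /= => /and3P[xy _ /andP[_ zx]] /and3P[_ /negP[]].
suff -> : y = last z s by rewrite mem_last.
rewrite (up y) -?memc ?inE ?eqxx ?orbT //; apply/esym/up; last by rewrite adjC.
by rewrite -memc 2!inE mem_last !orbT.
Qed.

(** Walking away from the root: if [g] did not send [x] to [f x], the edge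
    between them would come from [g (f x) = x], while [g (f x) = f (f x)] by
    induction, and [f] has no cycle of length 2. *)
Lemma edges_of_inj f g : rooted_map f -> rooted_map g ->
  edges_of f = edges_of g -> f = g.
Proof.
move=> rf rg efg; apply/ffunP => x; elim/(rooted_map_ind rf): x => [|x xr IHx].
  by rewrite !rooted_map_root.
have: adj (edges_of g) x (f x) by rewrite -efg adj_edges_of xr eqxx.
rewrite adj_edges_of => /orP[/andP[_ /eqP//]|/andP[_]].
by rewrite -IHx (negPf (rooted_map_neq2 rf xr)).
Qed.

(** The parent of a vertex is a neighbour closer to the root. An edge of [T]
    missing from the resulting spanning tree would close a cycle. *)
Lemma tree_edges_of (T : {set {set V}}) : is_tree T ->
  exists2 f, rooted_map f & T = edges_of f.
Proof.
case/and3P=> grT conT /acyclicP acT.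
have adjC : symmetric (adj T) by move=> x y; rewrite /adj finset.setUC.
have ltoE x : exists k,
    [exists c : k.-tuple V, path (adj T) x c && (last x c == rho)].
  have /connectP[c pc lc] := forallP (forallP conT x) rho.
  by exists (size c); apply/existsP; exists (in_tuple c); rewrite /= pc -lc eqxx.
pose dist x := ex_minn (ltoE x).
have closer x : exists y, (x != rho) ==> adj T x y && (dist y < dist x).
  have [->|xr] := eqVneq x rho; first by exists rho; rewrite ?eqxx.
  rewrite /= {2}/dist; case: ex_minnP => -[|k] /existsP[c /andP[]].
    by rewrite tuple0 /= (negPf xr).
  case: (tupleP c) => y c' /= /andP[xy pc'] lc' _; exists y; rewrite xy /=.
  rewrite /dist; case: ex_minnP => j _ /(_ k); rewrite ltnS; apply.
  by apply/existsP; exists c'; rewrite pc'.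
pose f := [ffun x => if x == rho then rho else xchoose (closer x)].
have fP x : x != rho -> adj T x (f x) && (dist (f x) < dist x).
  by move=> xr; have /implyP/(_ xr) := xchooseP (closer x); rewrite ffunE ifN.
have rf : rooted_map f.
  apply/andP; split; first by rewrite ffunE ifT.
  apply/forallP => x.
  have [k] := ubnP (dist x); elim: k x => // k IHk x.
  have [->|xr] := eqVneq x rho; first by rewrite connect0.
  have /andP[_ lt_fx] := fP x xr; rewrite ltnS => le_x.
  by apply: connect_trans (fconnect1 f x) (IHk _ (leq_trans lt_fx le_x)).
exists f => //.
have sub x y : adj (edges_of f) x y -> adj T x y.
  rewrite adj_edges_of => /orP[]/andP[zr /eqP <-]; last rewrite adjC.
    by case/andP: (fP x zr).
  by case/andP: (fP y zr).
apply/eqP; rewrite eqEsubset; apply/andP; split; apply/fintype.subsetP => e;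
  last first.
  case/imsetP=> x; rewrite inE => xr ->; apply: sub.
  by rewrite adj_edges_of eqxx andbT xr.
move=> eT; have /cards2P[x [y [xy e_xy]]] := forall_inP grT _ eT.
rewrite {e}e_xy in eT *; apply: contraT => exy.
have /and3P[_ /forallP/(_ y)/forallP/(_ x)/connectP[c pc lc] _] := edges_of_tree rf.
case: (shortenP pc) lc => c' pc' uc' _ lc'.
have := acT (y :: c'); rewrite /ucycle uc' andbT /= rcons_path -lc'.
rewrite (sub_path sub pc') /= => /(_ eT).
case: c' pc' {uc'} lc' => [_ /= xy'|z [|//]]; first by rewrite xy' eqxx in xy.
by move=> /= + zx; rewrite -zx andbT /adj finset.setUC => exy'; case/negP: exy.
Qed.

End RootedMaps.

(** * Double counting *)

Lemma card_dep_pairs (A X : finType) (S : {set A}) (F : A -> {set X}) :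
  #|[set u : A * X | (u.1 \in S) && (u.2 \in F u.1)]%SET| = \sum_(s in S) #|F s|.
Proof.
rewrite -sum1_card (eq_bigl (fun u => (u.1 \in S) && (u.2 \in F u.1))).
  rewrite -(pair_big_dep (mem S) (fun s => mem (F s)) (fun _ _ => 1)) /=.
  by apply: eq_bigr => s _; rewrite sum1_card.
by move=> u; rewrite inE.
Qed.

(** Each [s] in [S] admits at least [a] switchings, labelled by [F s]; [h] sends
    a switching to its result together with the data needed to undo it, for
    which at most [b] values are possible. *)
Lemma switching_bound (A B X Y : finType) (S : {set A}) (T : {set B})
    (F : A -> {set X}) (G : B -> {set Y}) (h : A * X -> B * Y) (a b : nat) :
  (forall s, s \in S -> a <= #|F s|) ->
  (forall t, t \in T -> #|G t| <= b) ->
  (forall s x, s \in S -> x \in F s ->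
     ((h (s, x)).1 \in T) && ((h (s, x)).2 \in G (h (s, x)).1)) ->
  {in [set u | (u.1 \in S) && (u.2 \in F u.1)]%SET &, injective h} ->
  #|S| * a <= #|T| * b.
Proof.
move=> leF leG hST h_inj.
have leS : #|S| * a <= \sum_(s in S) #|F s| by rewrite -sum_nat_const leq_sum.
have geT : \sum_(t in T) #|G t| <= #|T| * b by rewrite -sum_nat_const leq_sum.
apply: leq_trans leS (leq_trans _ geT).
rewrite -!card_dep_pairs -(card_in_imset h_inj) subset_leq_card //.
apply/fintype.subsetP => _ /imsetP[[s x] + ->]; rewrite !inE => /andP[].
exact: hST.
Qed.

(** * Trees with few leaves are rare *)

Section Leaves.
Variables (V : finType) (rho : V).
Implicit Types (f g : {ffun V -> V}) (x y : V).

(** The root, being a fixed point, is never counted as a leaf. *)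
Definition leaves f : {set V} := [set x | x \notin codom f]%SET.

Definition children f x : {set V} := [set y | f y == x]%SET.

Definition with_only_child f : {set V} :=
  [set x | (x != rho) && (#|children f x| == 1)]%SET.

Lemma leavesP f x : reflect (forall y, f y != x) (x \in leaves f).
Proof.
rewrite inE; apply: (iffP idP) => [xf y|xf].
  by apply: contraNneq xf => <-; apply: codom_f.
by apply/codomP=> -[y xfy]; have := xf y; rewrite xfy eqxx.
Qed.

(** The [n] vertices have [n] preimages in total, at least two for each vertex
    that is neither a leaf nor of in-degree one; hence there are at most as many
    of these branching vertices as leaves. The final [+ 1] accounts for the
    root, which [with_only_child] leaves out. *)
Lemma card_with_only_child f : #|V| <= #|with_only_child f| + 2 * #|leaves f| + 1.
Proof.
have card_V : #|V| = \sum_x #|children f x|.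
  rewrite -sum1_card (partition_big f predT) //=.
  by apply: eq_bigr => x _; rewrite -sum1_card; apply: eq_bigl => y; rewrite inE.
have pointwise x : 2 <= #|children f x| +
    ((x \in leaves f) + (x \in leaves f)) + (#|children f x| == 1).
  case: leavesP => [_|/leavesP xf]; first by lia.
  suff : 0 < #|children f x| by case: #|_| => [|[|n]].
  move: xf; rewrite inE negbK => /codomP[y ->].
  by apply/card_gt0P; exists y; rewrite inE.
have sum_bool (p : pred V) : \sum_x p x = #|[set x | p x]%SET|.
  rewrite -sum1_card [RHS]big_mkcond; apply: eq_bigr => x _.
  by rewrite inE; case: (p x).
have := @leq_sum _ (index_enum V) predT _ _ (fun x _ => pointwise x).
rewrite sum_nat_const !big_split /= -card_V !sum_bool.
have -> : [set x | x \in leaves f]%SET = leaves f by apply/setP=> x; rewrite inE.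
have le1 : #|[set x | #|children f x| == 1]%SET| <= #|with_only_child f| + 1.
  apply: leq_trans (_ : #|rho |: with_only_child f| <= _); last first.
    by rewrite cardsU1 addnC leq_add2l leq_b1.
  apply/subset_leq_card/fintype.subsetP=> x; rewrite !inE => ->.
  by rewrite andbT orbN.
move: le1; have -> : #|xpredT : pred V| = #|V| by apply: eq_card.
by clear; move: #|V| #|leaves f| #|with_only_child f| #|_| => a b c d; lia.
Qed.

(** Meaningful for [x] in [with_only_child f]; the default value [x] is
    arbitrary. *)
Definition child f x : V := odflt x [pick y in children f x].

(** The first surgery: [x] is taken out and becomes a leaf below [y]. *)
Definition rehang f (x y : V) : {ffun V -> V} :=
  [ffun z => if z == x then y else if z == child f x then f x else f z].

Lemma childP f x : x \in with_only_child f ->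
  f (child f x) = x /\ forall y, f y = x -> y = child f x.
Proof.
rewrite inE => /andP[_ /cards1P[a ch_x]].
suff -> : child f x = a.
  split; first by apply/eqP; have := set11 a; rewrite -ch_x inE.
  by move=> y fy; apply/set1P; rewrite -ch_x inE fy.
rewrite /child; case: pickP => [y|/(_ a)]; rewrite ch_x inE ?eqxx //.
by move/eqP.
Qed.

Lemma child_neq f x : rooted_map rho f -> x \in with_only_child f -> child f x != x.
Proof.
move=> rf xf; have [fc _] := childP xf.
have := xf; rewrite inE => /andP[xr _].
by apply: contraNneq (rooted_map_neq rf xr) => cx; rewrite -{1}cx fc.
Qed.

Lemma rehang_rooted f x y : rooted_map rho f -> x \in with_only_child f -> y != x ->
  rooted_map rho (rehang f x y).
Proof.
move=> rf xf yx; have [fc cP] := childP xf; have cx := child_neq rf xf.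
have := xf; rewrite inE => /andP[xr _].
have step z : z != x -> z != child f x -> rehang f x y z = f z.
  by move=> /negPf zx /negPf zc; rewrite ffunE zx zc.
have fixr : rehang f x y rho = rho.
  rewrite step; first exact: rooted_map_root rf.
    by rewrite eq_sym.
  by apply: contraNneq xr => rc; rewrite -fc -rc rooted_map_root.
(* At [x] the induction carries the claim for its parent, which the child of
   [x], now attached there, needs. *)
pose Q z := fconnect (rehang f x y) (if z == x then f x else z) rho.
have allQ z : Q z.
  elim/(rooted_map_ind rf): z => [|z zr Qz]; rewrite /Q.
    by rewrite [rho == x]eq_sym (negPf xr) connect0.
  have [zx|zx] := eqVneq z x.
    by move: Qz; rewrite /Q zx (negPf (rooted_map_neq rf xr)).
  apply: connect_trans (fconnect1 _ _) _.
  have [fzx|fzx] := eqVneq (f z) x.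
    move: Qz; rewrite /Q fzx eqxx (cP _ fzx).
    by rewrite /= ffunE (negPf cx) eqxx.
  move: Qz; rewrite /Q (negPf fzx) step //.
  by apply: contraNneq fzx => ->; rewrite fc.
apply/andP; split; [exact/eqP | apply/forallP => z].
have [->|zx] := eqVneq z x; last by have := allQ z; rewrite /Q (negPf zx).
apply: connect_trans (fconnect1 _ _) _; rewrite /= ffunE eqxx.
by have := allQ y; rewrite /Q (negPf yx).
Qed.

Lemma leaves_rehang f x y : rooted_map rho f -> x \in with_only_child f -> y != x ->
  leaves (rehang f x y) \subset x |: leaves f.
Proof.
move=> rf xf yx; have [fc cP] := childP xf; have cx := child_neq rf xf.
apply/fintype.subsetP => z /leavesP zl; rewrite in_setU1.
have [//|zx /=] := eqVneq z x; apply/leavesP => w; apply: contraNneq zx => fw.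
have [wx|wx] := eqVneq w x.
  by case/eqP: (zl (child f x)); rewrite ffunE (negPf cx) eqxx -fw wx.
have [wc|wc] := eqVneq w (child f x); first by rewrite -fw wc fc.
by case/eqP: (zl w); rewrite ffunE (negPf wx) (negPf wc).
Qed.

Lemma rehang_leaf f x y : rooted_map rho f -> x \in with_only_child f -> y != x ->
  x \in leaves (rehang f x y).
Proof.
move=> rf xf yx; have [fc cP] := childP xf.
have := xf; rewrite inE => /andP[xr _].
apply/leavesP => z; rewrite ffunE; case: (eqVneq z x) => [//|zx].
case: (eqVneq z (child f x)) => zc; first exact: rooted_map_neq rf xr.
by apply: contraNneq zc => /cP/eqP.
Qed.

Lemma rehang_inj f g x y y' :
  rooted_map rho f -> rooted_map rho g ->
  x \in with_only_child f -> x \in with_only_child g ->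
  child f x = child g x -> rehang f x y = rehang g x y' -> f = g /\ y = y'.
Proof.
move=> rf rg xf xg eqc /ffunP efg; have [fc _] := childP xf; have [gc _] := childP xg.
split; last by have := efg x; rewrite !ffunE eqxx.
apply/ffunP => z; have := efg z; rewrite !ffunE -eqc.
have [zx _|zx] := eqVneq z x.
  have := efg (child f x); rewrite !ffunE -eqc (negPf (child_neq rf xf)) eqxx.
  by rewrite zx.
by case: eqVneq => [->|//] _; rewrite fc eqc gc.
Qed.

Definition rooted_maps : {set {ffun V -> V}} := [set f | rooted_map rho f]%SET.

Definition few_leaves m : {set {ffun V -> V}} :=
  [set f in rooted_maps | #|leaves f| <= m]%SET.

(** A switching is a choice of [x] and [y]; it is undone from [x], which is now
    one of at most [m + 1] leaves, and from the former child of [x]. *)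
Lemma few_leaves_rare m :
  #|few_leaves m| * ((#|V| - (2 * m).+1) * #|V|.-1) <=
  #|rooted_maps| * (m.+1 * #|V|).
Proof.
pose F f := [set u : V * V | (u.1 \in with_only_child f) && (u.2 \in [set~ u.1])]%SET.
pose T := few_leaves m.+1.
pose G f := finset.setX (leaves f) [set: V]%SET.
pose h (u : {ffun V -> V} * (V * V)) :=
  (rehang u.1 u.2.1 u.2.2, (u.2.1, child u.1 u.2.1)).
apply: leq_trans (_ : #|T| * (m.+1 * #|V|) <= _); last first.
  rewrite leq_mul2r subset_leq_card ?orbT //.
  by apply/fintype.subsetP => f; rewrite inE => /andP[].
apply: (@switching_bound _ _ _ _ _ _ F G h).
- move=> f; rewrite inE => /andP[_ lef].
  rewrite /F (card_dep_pairs _ (fun x => [set~ x]%SET)).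
  rewrite (eq_bigr (fun=> #|V|.-1)) => [|x _]; last first.
    by rewrite cardsC1.
  rewrite sum_nat_const leq_mul2r; apply/orP; right.
  by have := card_with_only_child f; lia.
- move=> f; rewrite inE => /andP[_ lef].
  by rewrite cardsX cardsT leq_mul2r lef orbT.
- move=> f [x y] /setIdP[+ lef]; rewrite inE => rf.
  rewrite inE => /andP[/= xf]; rewrite in_setC1 => yx; apply/andP; split.
    apply/setIdP; split; first by rewrite inE rehang_rooted.
    apply: leq_trans (subset_leq_card (leaves_rehang rf xf yx)) _.
    by rewrite cardsU1; case: (_ \notin _); rewrite ?ltnS // ltnW.
  by rewrite in_setX in_setT andbT rehang_leaf.
move=> [f [x y]] [g [x' y']]; rewrite 2!inE /= => /andP[/setIdP[+ _]].
rewrite inE => rf /=; rewrite inE => /andP[/= xf _] /andP[/setIdP[+ _]].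
rewrite inE => rg; rewrite inE => /andP[/= xg _] [efg exx ec].
rewrite -{x'}exx in xg ec efg *.
by have [->->] := rehang_inj rf rg xf xg ec efg.
Qed.

End Leaves.

(** * Planted copies of a rooted tree *)

Lemma mem_imset_codom (aT rT : finType) (phi : {ffun aT -> rT}) x :
  (x \in phi @: [set: aT]%SET) = (x \in codom phi).
Proof. by apply/imsetP/codomP => -[u] => [_|] ->; exists u. Qed.

Section Planting.
Variables (U V : finType) (v : U) (rho : V) (par : {ffun U -> U}).
Hypothesis par_rooted : rooted_map v par.
Implicit Types (f g : {ffun V -> V}) (phi psi : {ffun U -> V}) (x y z : V) (u : U).

(** A pattern together with a chosen isomorphism. Keeping the isomorphism turns
    the choice of a copy into the choice of an injection; this overcounts each
    vertex set by a factor depending on [U] only, which is harmless. *)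
Definition planted f phi : bool :=
  [&& injectiveb phi,
      [forall u in predC1 v, f (phi u) == phi (par u)],
      f (phi v) \notin codom phi &
      [forall x, (f x \in codom phi) ==> (x \in codom phi)]].

Lemma plantedP f phi : reflect
  [/\ injective phi, forall u, u != v -> f (phi u) = phi (par u),
      f (phi v) \notin codom phi &
      forall x, f x \in codom phi -> x \in codom phi]
  (planted f phi).
Proof.
apply: (iffP and4P) => -[phiI phiP phiv phiC]; split=> //.
- exact/injectiveP.
- by move=> u uv; apply/eqP/(forall_inP phiP).
- by move=> x; apply/implyP/(forallP phiC).
- exact/injectiveP.
- by apply/forall_inP => u uv; apply/eqP/phiP.
- by apply/forallP => x; apply/implyP/phiC.
Qed.

Lemma planted_neq_root f phi u : f rho = rho -> planted f phi -> phi u != rho.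
Proof.
move=> f_rho /plantedP[_ phiP phiv _].
elim/(rooted_map_ind par_rooted): u => [|u uv].
  by apply: contraNneq phiv => phi_v; rewrite phi_v f_rho -phi_v codom_f.
by rewrite -phiP //; apply: contraNneq => ->; rewrite f_rho.
Qed.

Lemma card_codom_planted f phi : planted f phi -> #|phi @: [set: U]| = #|U|.
Proof. by case/plantedP=> phiI _ _ _; rewrite card_imset // cardsT. Qed.

Lemma adj_induced (T : {set {set V}}) (W : {set V}) x y :
  adj (Defs.induced T W) x y = [&& adj T x y, x \in W & y \in W].
Proof. by rewrite /adj inE subUset !sub1set. Qed.

Lemma planted_pattern f phi : rooted_map rho f -> planted f phi ->
  is_pattern (edges_of v par) v (edges_of rho f) (phi v) (phi @: [set: U]).
Proof.
move=> rf phiPl; have [phiI phiP phiv phiC] := plantedP _ _ phiPl.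
have phir u := planted_neq_root u (rooted_map_root rf) phiPl.
set W := phi @: _.
have memW x : (x \in W) = (x \in codom phi) by apply: mem_imset_codom.
have phiW u : phi u \in W by rewrite memW codom_f.
have fW u : u != v -> f (phi u) \in W by move=> uv; rewrite phiP.
have nbrW x y : f y = x -> x \in W -> y \in W by move=> <-; rewrite !memW; apply: phiC.
apply/and5P; split=> //; first by rewrite (card_codom_planted phiPl).
- pose psi := [ffun x => odflt v [pick u | phi u == x]].
  have phiK u : psi (phi u) = u.
    rewrite ffunE; case: pickP => [u' /eqP/phiI //|/(_ u)]; by rewrite eqxx.
  apply/existsP; exists psi; apply/and4P; split; first by rewrite phiK.
  + apply/dinjectiveP => _ _ /imsetP[a _ ->] /imsetP[b _ ->].
    by rewrite !phiK => ->.
  + apply/eqP/setP => u; rewrite inE; apply/imsetP; exists (phi u) => //.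
  + apply/forall_inP => _ /imsetP[a _ ->]; apply/forall_inP => _ /imsetP[b _ ->].
    rewrite adj_induced !phiW !andbT !phiK !adj_edges_of !phir /=.
    have fphiE c d : (f (phi c) == phi d) = (c != v) && (par c == d).
      have [->|cv] /= := eqVneq c v; last by rewrite phiP // (inj_eq phiI).
      by apply: contraNF phiv => /eqP->; rewrite codom_f.
    by rewrite !fphiE.
- rewrite /deg; have fvW : f (phi v) \notin W by rewrite memW.
  have -> : [set y | adj (edges_of rho f) (phi v) y]%SET =
      f (phi v) |: [set y | adj (Defs.induced (edges_of rho f) W) (phi v) y]%SET.
    apply/setP => y; rewrite in_setU1 !inE adj_induced phiW /= !adj_edges_of phir /=.
    rewrite [f _ == y]eq_sym; case: (y == f _) => //=.
    by case: (f y =P phi v) => [/nbrW/(_ (phiW v))->|]; rewrite ?andbT ?andbF.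
  by rewrite cardsU1 inE adj_induced (negPf fvW) !andbF.
apply/forall_inP => _ /imsetP[u _ ->]; apply/implyP; rewrite (inj_eq phiI) => uv.
apply/eqP/eq_card => y; rewrite !inE adj_induced phiW /=.
case: (boolP (adj _ _ _)) => //=; rewrite adj_edges_of => /orP[]/andP[_ /eqP].
  by move<-; rewrite fW.
by move/nbrW/(_ (phiW u)) ->.
Qed.

(** The vertices of a planted copy are exactly the descendants of its root. *)
Lemma planted_codom_sub f phi psi k :
  planted f phi -> planted f psi -> iter k f (phi v) = psi v ->
  {subset codom phi <= codom psi}.
Proof.
move=> /plantedP[_ phiP _ _] /plantedP[_ _ _ psiC] phi_psi _ /codomP[u ->].
elim/(rooted_map_ind par_rooted): u => [|u uv]; last by rewrite -phiP // => /psiC.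
elim: k (phi v) phi_psi => [|k IHk] x; first by move=> /= ->; apply: codom_f.
by rewrite iterSr => /IHk /psiC.
Qed.

(** The roots of the two copies are both ancestors of [y], so one of them is a
    descendant of the other; the copies are then nested, hence equal, having the
    same number of vertices. *)
Lemma planted_overlap f phi psi y : planted f phi -> planted f psi ->
  y \in codom phi -> y \in codom psi -> phi @: [set: U] = psi @: [set: U].
Proof.
move=> phiPl psiPl yphi ypsi.
have toroot chi : planted f chi -> y \in codom chi -> exists k, iter k f y = chi v.
  move=> /plantedP[_ chiP _ _] /codomP[u ->].
  elim/(rooted_map_ind par_rooted): u => [|u uv [k]]; first by exists 0.
  by rewrite -chiP // -iterSr; exists k.+1.
have [k yk] := toroot _ phiPl yphi; have [l yl] := toroot _ psiPl ypsi.
have sub chi chi' i j : planted f chi -> planted f chi' -> i <= j ->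
    iter i f y = chi v -> iter j f y = chi' v -> chi @: [set: U] = chi' @: [set: U].
  move=> chiPl chiPl' ij yi yj; apply/eqP.
  rewrite eqEcard !(card_codom_planted (f := f)) // leqnn andbT.
  apply/fintype.subsetP => x; rewrite !mem_imset_codom.
  by apply: (planted_codom_sub (k := j - i) chiPl chiPl'); rewrite -yi -iterD subnK.
case: (leqP k l) => kl; first exact: sub kl yk yl.
by apply/esym; apply: sub (ltnW kl) yl yk.
Qed.

(** By [planted_overlap] all these copies have the same [#|U|] vertices. *)
Lemma card_planted_at f y :
  #|[set phi | planted f phi && (y \in codom phi)]%SET| <= #|U| ^ #|U|.
Proof.
have [->|[phi]] := set_0Vmem [set phi | planted f phi && (y \in codom phi)]%SET.
  by rewrite cards0.
rewrite inE => /andP[phiPl yphi].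
rewrite -{1}(card_codom_planted phiPl) -card_ffun_on.
apply/subset_leq_card/fintype.subsetP => psi; rewrite inE => /andP[psiPl ypsi].
by apply/ffun_onP => u; rewrite (planted_overlap phiPl psiPl yphi ypsi) imset_f.
Qed.

(** The second surgery: the vertices [phi u] are rearranged into a copy of the
    tree [par], whose root [phi v] keeps its parent. *)
Definition graft f phi : {ffun V -> V} :=
  [ffun z => if [pick u in predC1 v | phi u == z] is Some u then phi (par u)
             else f z].

Lemma graft_on f phi u : injective phi -> u != v ->
  graft f phi (phi u) = phi (par u).
Proof.
move=> phiI uv; rewrite ffunE; case: pickP => [u' /andP[_ /eqP/phiI->//]|/(_ u)].
by rewrite inE uv eqxx.
Qed.

Lemma graft_off f phi z : (forall u, u != v -> phi u != z) -> graft f phi z = f z.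
Proof.
move=> zP; rewrite ffunE; case: pickP => // u /andP[uv].
by rewrite (negPf (zP u uv)).
Qed.

Lemma graft_off_codom f phi z : z \notin codom phi -> graft f phi z = f z.
Proof.
move=> zphi; apply: graft_off => u _.
by apply: contraNneq zphi => <-; apply: codom_f.
Qed.

Lemma graft_inj f g phi : (forall u, u != v -> f (phi u) = g (phi u)) ->
  graft f phi = graft g phi -> f = g.
Proof.
move=> fg /ffunP gr; apply/ffunP => z.
have [/exists_inP[u uv /eqP <-]|/exists_inPn zP] :=
  boolP [exists u in predC1 v, phi u == z]; first exact: fg.
by have := gr z; rewrite !graft_off.
Qed.

Definition on_leaves f phi := injectiveb phi && [forall u, phi u \in leaves f].

Lemma on_leavesP f phi :
  on_leaves f phi -> injective phi /\ forall z, f z \notin codom phi.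
Proof.
case/andP=> /injectiveP phiI /forallP phil; split=> // z.
by apply/codomP => -[u fz]; have /leavesP/(_ z) := phil u; rewrite fz eqxx.
Qed.

Lemma graft_planted f phi : on_leaves f phi -> planted (graft f phi) phi.
Proof.
case/on_leavesP=> phiI f_phi.
apply/plantedP; split=> // [u uv||x]; first exact: graft_on.
  rewrite graft_off // => u; by rewrite (inj_eq phiI).
have [//|xphi] := boolP (x \in codom phi).
by rewrite graft_off_codom ?(negPf (f_phi _)).
Qed.

Lemma graft_rooted f phi :
  rooted_map rho f -> on_leaves f phi -> rooted_map rho (graft f phi).
Proof.
move=> rf /on_leavesP[phiI f_phi].
have rho_phi : rho \notin codom phi by rewrite -(rooted_map_root rf).
have conn z : z \notin codom phi -> fconnect (graft f phi) z rho.
  elim/(rooted_map_ind rf): z => [_|z zr IHz zphi]; first exact: connect0.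
  by apply: connect_trans (fconnect1 _ _) _; rewrite /= graft_off_codom // IHz.
apply/andP; split; first by rewrite graft_off_codom // (rooted_map_root rf).
apply/forallP => z; have [/codomP[u ->]|] := boolP (z \in codom phi); last exact: conn.
elim/(rooted_map_ind par_rooted): u => [|u uv IHu].
  apply: connect_trans (fconnect1 _ _) _; rewrite /= graft_off ?conn // => u.
  by rewrite (inj_eq phiI).
by apply: connect_trans (fconnect1 _ _) _; rewrite /= graft_on.
Qed.

Definition pattern_free : {set {ffun V -> V}} :=
  [set f in rooted_maps rho | [forall phi, ~~ planted f phi]]%SET.

(** A copy that contains neither a moved leaf nor the old parent of one is not
    affected by the surgery, hence was already planted in [f]. *)
Lemma new_planted f phi psi : f \in pattern_free ->
  planted (graft f phi) psi ->
  exists2 y, y \in phi @: [set: U] :|: (f \o phi) @: [set: U] & y \in codom psi.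
Proof.
case/setIdP=> _ /forallP/(_ psi) fpsi psiPl.
apply/exists_inP; apply: contraR fpsi => /exists_inPn disj.
have phi_psi u : phi u \notin codom psi.
  by apply: disj; apply/setUP; left; apply: imset_f.
have fphi_psi u : f (phi u) \notin codom psi.
  by apply: disj; apply/setUP; right; apply/imsetP; exists u.
have [psiI psiP psiv psiC] := plantedP _ _ psiPl.
have fpsi u : graft f phi (psi u) = f (psi u).
  apply: graft_off_codom; apply/codomP => -[u' eu].
  by have := phi_psi u'; rewrite -eu codom_f.
apply/plantedP; split=> // [u uv||x].
- by rewrite -fpsi psiP.
- by rewrite -fpsi.
have [/codomP[u ->]|xphi] := boolP (x \in codom phi).
  by rewrite (negPf (fphi_psi u)).
by rewrite -(@graft_off_codom _ phi) //; apply: psiC.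
Qed.

(** How many copies in [g] may be the one created by the surgery: pick one way
    in which [g] arises, from [f] and [phi]; by [new_planted] every candidate
    meets one of [2 * #|U|] vertices read off from [f] and [phi]. *)
Lemma card_new_planted g :
  #|[set phi | [exists f in pattern_free,
                  on_leaves f phi && (graft f phi == g)]]%SET|
  <= 2 * #|U| * #|U| ^ #|U|.
Proof.
set N := [set phi | _]%SET; have [->|[phi]] := set_0Vmem N; first by rewrite cards0.
rewrite inE => /exists_inP[f fN /andP[phiL /eqP gE]].
pose Y := phi @: [set: U] :|: (f \o phi) @: [set: U].
pose at_ y := [set psi | planted g psi && (y \in codom psi)]%SET.
have NY : N \subset \bigcup_(y in Y) at_ y.
  apply/fintype.subsetP => psi; rewrite inE => /exists_inP[f' _ /andP[psiL /eqP gE']].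
  have psiPl : planted g psi by rewrite -gE' graft_planted.
  have [|y yY ypsi] := @new_planted f phi psi fN; first by rewrite gE.
  by apply/bigcupP; exists y => //; rewrite inE psiPl.
have cardY : #|Y| <= 2 * #|U|.
  rewrite mul2n -addnn; apply: leq_trans (leq_card_setU _ _) _.
  by rewrite -[#|U|]cardsT leq_add ?leq_imset_card.
apply: leq_trans (subset_leq_card NY) _.
apply: leq_trans (_ : \sum_(y in Y) #|at_ y| <= _).
  apply: (big_ind2 (fun (A : {set {ffun U -> V}}) n => #|A| <= n)) => //.
    by rewrite cards0.
  move=> A a B b Aa Bb; apply: leq_trans (leq_card_setU _ _) _; exact: leq_add.
apply: leq_trans (_ : #|Y| * #|U| ^ #|U| <= _); last by rewrite leq_mul2r cardY orbT.
by rewrite -sum_nat_const leq_sum // => y _; apply: card_planted_at.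
Qed.

Lemma leq_ffact m n k : m <= n -> m ^_ k <= n ^_ k.
Proof.
elim: k m n => [//|k IHk] [|m] [|n] // mn.
by rewrite !ffactnS leq_mul // IHk.
Qed.

(** A switching is a choice of [#|U|] leaves in order; it is undone from the
    copy and from the old parents of its vertices other than the root. *)
Lemma pattern_free_rare m :
  #|pattern_free :\: few_leaves rho m| * m.+1 ^_ #|U| <=
  #|rooted_maps rho| * (2 * #|U| * #|U| ^ #|U| * #|V| ^ #|U|.-1).
Proof.
pose F f := [set phi in ffun_on (mem (leaves f)) | injectiveb (phi : {ffun U -> V})]%SET.
(* The root of the copy keeps its parent: the value recorded for it is the
   dummy [rho], which saves a factor [#|V|]. *)
pose D : {set {ffun U -> V}} := [set s in pffun_on rho (predC1 v) predT]%SET.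
pose G g := finset.setX
  [set phi | [exists f in pattern_free,
                on_leaves f phi && (graft f phi == g)]]%SET D.
pose h (w : {ffun V -> V} * {ffun U -> V}) :
    {ffun V -> V} * ({ffun U -> V} * {ffun U -> V}) :=
  (graft w.1 w.2, (w.2, [ffun u => if u == v then rho else w.1 (w.2 u)])).
have FE f phi : (phi \in F f) = on_leaves f phi.
  rewrite inE andbC; congr andb; apply/ffun_onP/forallP => phil u; exact: phil.
apply: (@switching_bound _ _ _ _ _ _ F G h).
- move=> f /setDP[/setIdP[fr _] few]; rewrite card_inj_ffuns_on leq_ffact //.
  by move: few; rewrite inE fr /= -ltnNge.
- move=> g _; rewrite cardsX leq_mul // ?card_new_planted //.
  by rewrite cardsE card_pffun_on cardC1 cardT -cardE.
- move=> f phi /setDP[fN _]; rewrite FE => phiL.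
  have /setIdP[+ _] := fN; rewrite inE => rf.
  rewrite inE graft_rooted //= in_setX !inE /=; apply/andP; split.
    by apply/exists_inP; exists f; rewrite ?phiL /=.
  apply/pffun_onP; split=> // ; apply/fintype.subsetP => u; rewrite !inE ffunE.
  by apply: contra => ->.
move=> [f phi] [g psi] _ _ [gr eq_phi /ffunP fg]; rewrite -{psi}eq_phi in gr fg *.
congr pair; apply: graft_inj gr => u uv.
by have := fg u; rewrite !ffunE (negPf uv).
Qed.

End Planting.

(** * Asymptotics *)

Lemma leq_exp_ffact m k : (m - k) ^ k <= m ^_ k.
Proof.
elim: k m => [//|k IHk] [|m]; first by rewrite sub0n exp0n.
by rewrite expnS ffactnS subSS leq_mul ?IHk //; lia.
Qed.

(** Of the constant [17], trees with at most [n / k] leaves account for [16], by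
    [few_leaves_rare], and the others for [1], by [pattern_free_rare]. *)
Lemma pattern_free_negligible (U : finType) (v : U) (par : {ffun U -> U}) (k : nat) :
  rooted_map v par -> 3 < k -> exists N, forall (V : finType) (rho : V),
    N <= #|V| -> k * #|pattern_free v rho par| <= 17 * #|rooted_maps rho|.
Proof.
move=> par_rooted k_gt3; set q := #|U|.
have q_gt0 : 0 < q by apply/card_gt0P; exists v.
pose K := 2 * q * q ^ q; exists (8 + k + 2 * k * q + k * K * (2 * k) ^ q).
move=> V rho; set n := #|V| => le_n.
pose m := n %/ k.
have m_le : m * k <= n by apply: leq_trunc_div.
have m_gt : n < m.+1 * k by apply: ltn_ceil; lia.
have m4 : 4 * m <= n by apply: leq_trans m_le; rewrite mulnC leq_mul2l k_gt3 orbT.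
set S := pattern_free _ _ _; set t := #|rooted_maps rho|.
rewrite -(cardsID (few_leaves rho m) S) mulnDr (_ : 17 * t = 16 * t + t); last by lia.
have n_gt0 : 0 < n by lia.
apply: leq_add.
- set a := #|_|; have := few_leaves_rare rho m; rewrite -/n -/t => few.
  have {few} : a * ((n - (2 * m).+1) * n.-1) <= t * (m.+1 * n).
    by apply: leq_trans few; rewrite leq_mul2r subset_leq_card ?orbT ?finset.subsetIr.
  have h1 : n <= 4 * (n - (2 * m).+1) by lia.
  have h2 : n <= 2 * n.-1 by lia.
  have h3 : k * m.+1 <= 2 * n by rewrite mulnS [k * m]mulnC; lia.
  move=> few; rewrite -(leq_pmul2r (m := n * n)); last by rewrite muln_gt0 n_gt0.
  apply: leq_trans (_ : 8 * k * (a * ((n - (2 * m).+1) * n.-1)) <= _).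
    apply: leq_trans (_ : k * a * ((4 * (n - (2 * m).+1)) * (2 * n.-1)) <= _).
      by rewrite leq_mul2l leq_mul ?orbT.
    by rewrite leq_eqVlt; apply/orP; left; apply/eqP; lia.
  apply: leq_trans (_ : 8 * k * (t * (m.+1 * n)) <= _).
    by rewrite leq_mul2l few orbT.
  apply: leq_trans (_ : 8 * t * n * (k * m.+1) <= _).
    by rewrite leq_eqVlt; apply/orP; left; apply/eqP; lia.
  apply: leq_trans (_ : 8 * t * n * (2 * n) <= _); first by rewrite leq_mul2l h3 orbT.
  by rewrite leq_eqVlt; apply/orP; left; apply/eqP; lia.
have := pattern_free_rare rho par_rooted m; rewrite -/S -/q -/n -/t -/K.
move: K le_n => K le_n; set a := #|_| => rare.
have n_le : n <= 2 * k * (m.+1 - q).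
  rewrite mulnBr; move: m_gt le_n; rewrite [_ * k]mulnC => m_gt.
  by rewrite -mulnA; move: (k * m.+1) (k * q) m_gt (k * K * _) => *; lia.
have nq_le : n ^ q <= (2 * k) ^ q * m.+1 ^_ q.
  apply: leq_trans (leq_mul (leqnn _) (leq_exp_ffact _ _)).
  by rewrite -expnMn leq_exp2r.
have an_le : a * n <= (2 * k) ^ q * K * t.
  rewrite -(leq_pmul2r (m := n ^ q.-1)); last by rewrite expn_gt0 n_gt0.
  rewrite -mulnA -expnS prednK //.
  apply: leq_trans (leq_mul (leqnn a) nq_le) _.
  rewrite mulnCA -!mulnA leq_mul //.
  by apply: leq_trans rare _; rewrite mulnCA.
rewrite -(leq_pmul2r n_gt0) -mulnA.
apply: leq_trans (leq_mul (leqnn k) an_le) _.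
rewrite mulnA [_ ^ q * K]mulnC !mulnA mulnC leq_mul2l; apply/orP; right.
by apply: leq_trans le_n; apply: leq_addl.
Qed.

Lemma labelled_trees_edges_of n :
  labelled_trees n.+1 = (edges_of ord0 @: rooted_maps (@ord0 n))%SET.
Proof.
apply/setP => T; rewrite inE; apply/idP/imsetP => [/(tree_edges_of ord0)[f rf ->]|].
  by exists f; rewrite ?inE.
by case=> f; rewrite inE => rf ->; apply: edges_of_tree.
Qed.

Lemma card_labelled_trees n : #|labelled_trees n.+1| = #|rooted_maps (@ord0 n)|.
Proof.
rewrite labelled_trees_edges_of card_in_imset // => f g; rewrite !inE.
exact: edges_of_inj.
Qed.

Lemma labelled_trees_gt0 n : 0 < #|labelled_trees n.+1|.
Proof.
rewrite card_labelled_trees; apply/card_gt0P; exists [ffun=> ord0].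
rewrite inE; apply/andP; split; first by rewrite ffunE.
by apply/forallP => x; apply: connect1; rewrite /= ffunE.
Qed.

Lemma patternless_trees_rare (U : finType) (P : {set {set U}}) (v : U) k :
  is_tree P -> 3 < k -> exists N, forall n, N <= n ->
  k * #|labelled_trees n :\: [set T | (1 <= num_patterns P v T)]%SET|
    <= 17 * #|labelled_trees n|.
Proof.
move=> /(tree_edges_of v)[par par_rooted ->] k_gt3.
have [N NP] := pattern_free_negligible par_rooted k_gt3.
exists N.+1 => -[//|n] le_N; rewrite card_labelled_trees.
apply: leq_trans (NP _ (@ord0 n) _); last by rewrite card_ord ltnW.
rewrite leq_mul2l; apply/orP; right.
apply: leq_trans (leq_imset_card (edges_of ord0) _).
apply/subset_leq_card/fintype.subsetP => T.
rewrite finset.in_setD labelled_trees_edges_of andbC => /andP[/imsetP[f f_rooted ->]].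
rewrite inE lt0n negbK => /eqP/cards0_eq no_pat.
apply/imset_f/setIdP; split=> //; apply/forallP => phi; apply/negP => phiPl.
rewrite inE in f_rooted; have pat := planted_pattern par_rooted f_rooted phiPl.
have : (phi v, phi @: [set: U])%SET \in (finset.set0 : {set 'I_n.+1 * {set 'I_n.+1}}).
  by rewrite -no_pat inE.
by rewrite inE.
Qed.

Local Open Scope classical_set_scope.
Local Open Scope ring_scope.

Theorem theorem3p1 (R : realType) (p : nat) (U : finType) (P : {set {set U}})
    (v : U) (hU : #|U| = p.+1) (hP : is_tree P) :
  (fun n : nat => uniform_pr R (labelled_trees n)
     [set T : {set {set 'I_n}} | (1 <= num_patterns P v T)%N]%SET)
    @ \oo --> (1 : R).
Proof.
apply/cvgrPdist_le => e e_gt0.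
have e17_ge0 : 0 <= 17 / e by rewrite divr_ge0 // ltW.
pose k := (Num.bound (17 / e) + 4)%N.
have k_gt3 : (3 < k)%N by rewrite /k; lia.
have [N NP] := patternless_trees_rare v hP k_gt3.
exists N.+1 => // -[//|n] /= le_N; have {}NP := NP _ (ltnW le_N).
rewrite /uniform_pr; set Om := labelled_trees n.+1 in NP *.
set A := [set T | _]%SET in NP *.
have Om_gt0 : 0 < #|Om|%:R :> R by rewrite ltr0n labelled_trees_gt0.
have -> : 1 - #|A :&: Om|%:R / #|Om|%:R = #|Om :\: A|%:R / #|Om|%:R :> R.
  rewrite -{1}(divff (lt0r_neq0 Om_gt0)) -mulrBl -{1}(cardsID A Om) finset.setIC.
  by rewrite natrD addrC addKr.
rewrite ger0_norm ?divr_ge0 // ler_pdivrMr //.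
have k_ge : 17 <= k%:R * e.
  rewrite -ler_pdivrMr // ltW // (lt_le_trans (archi_boundP e17_ge0)) //.
  by rewrite ler_nat leq_addr.
have k_gt0 : 0 < k%:R :> R by rewrite ltr0n; lia.
rewrite -(ler_pM2l k_gt0) mulrA; apply: le_trans (_ : 17 * #|Om|%:R <= _).
  by rewrite -!natrM ler_nat.
by rewrite ler_wpM2r // ltW.
Qed.
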